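(* Let $\mathcal{D}$ be a domain and let $G<\mathrm{IET}(\mathcal{D})$ be a finitely generated subgroup. Then $G$ has a finite index subgroup that is stable.
   Context: A domain is a non-empty disjoint union of finitely many oriented circles and oriented half-open bounded intervals closed on the left. A subdomain of $\mathcal{D}$ is a subset of $\mathcal{D}$ which is itself a domain (a finite disjoint union of such circles and half-open intervals). $\mathrm{IET}(\mathcal{D})$ is the group of bijections of $\mathcal{D}$ that are orientation-preserving piecewise isometries, left-continuous, with finitely many discontinuity points. A finitely generated subgroup $G<\mathrm{IET}(\mathcal{D})$ is called stable if every subdomain $J\subset\mathcal{D}$ which is invariant under some finite index subgroup of $G$ is $G$-invariant. *)

(* Defs.v *)
From mathcomp Require Import all_boot all_order all_algebra.
From mathcomp Require Import reals.
From Stdlib Require List.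

Set Implicit Arguments.
Unset Strict Implicit.
Unset Printing Implicit Defensive.

Import Order.TTheory GRing.Theory Num.Theory.
Local Open Scope ring_scope.

(* A domain: finitely many (ncomp >= 1) components; component i has length
   len i > 0 and is either an oriented circle R/(len i)Z (is_circle i = true)
   or the oriented half-open interval [0, len i). Points of component i are
   parametrized by a coordinate x with 0 <= x < len i (orientation = increasing x). *)
Record domain (R : realType) := Domain {
  ncomp : nat;
  len : 'I_ncomp -> R;
  is_circle : 'I_ncomp -> bool;
  ncomp_gt0 : (0 < ncomp)%N;
  len_gt0 : forall i, 0 < len i
}.

Record point (R : realType) (D : domain R) := Point {
  comp : 'I_(ncomp D);
  coord : R;
  coord_ge0 : 0 <= coord;
  coord_lt : coord < len comp
}.

Definition in_piece (R : realType) (D : domain R)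
  (pc : 'I_(ncomp D) * R * R) (p : point D) : Prop :=
  comp p = pc.1.1 /\ pc.1.2 <= coord p /\ coord p < pc.2.

Definition acts_as_translation (R : realType) (D : domain R)
  (f : point D -> point D) (pc : 'I_(ncomp D) * R * R) (j : 'I_(ncomp D)) (c : R) : Prop :=
  forall p, in_piece pc p -> comp (f p) = j /\ coord (f p) = coord p + c.

(* IET(D): bijections of D which are orientation-preserving piecewise
   isometries, continuous on every half-open piece [a,b) (closed on the left),
   with finitely many pieces (hence finitely many discontinuity points). *)
Definition is_IET (R : realType) (D : domain R) (f : point D -> point D) : Prop :=
  bijective f /\
  exists pieces : seq ('I_(ncomp D) * R * R * 'I_(ncomp D) * R),
    (forall p, exists pc, List.In pc pieces /\ in_piece pc.1.1 p) /\
    (forall pc, List.In pc pieces -> acts_as_translation f pc.1.1 pc.1.2 pc.2).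

Definition is_subgroup (R : realType) (D : domain R)
  (H : (point D -> point D) -> Prop) : Prop :=
  H id /\
  (forall f g, H f -> H g -> H (f \o g)) /\
  (forall f, H f -> exists g, H g /\ cancel f g /\ cancel g f).

Definition generated (R : realType) (D : domain R)
  (gens : seq (point D -> point D)) (f : point D -> point D) : Prop :=
  forall H, is_subgroup H -> (forall g, List.In g gens -> H g) -> H f.

Definition finitely_generated (R : realType) (D : domain R)
  (G : (point D -> point D) -> Prop) : Prop :=
  exists gens : seq (point D -> point D),
    forall f, G f <-> generated gens f.

Definition finite_index_subgroup (R : realType) (D : domain R)
  (H G : (point D -> point D) -> Prop) : Prop :=
  is_subgroup H /\ (forall h, H h -> G h) /\
  exists reps : seq (point D -> point D),
    forall g, G g -> exists r h, List.In r reps /\ H h /\ g = r \o h.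

(* A subdomain: a non-empty subset J of D which is itself a domain, i.e. whose
   trace on each component is a finite union of half-open coordinate intervals
   [a, b). *)
Definition is_subdomain (R : realType) (D : domain R) (J : point D -> Prop) : Prop :=
  (exists p, J p) /\
  forall i : 'I_(ncomp D), exists s : seq (R * R),
    forall p, comp p = i ->
      (J p <-> has (fun ab => (ab.1 <= coord p) && (coord p < ab.2)) s).

Definition invariant (R : realType) (D : domain R)
  (G : (point D -> point D) -> Prop) (J : point D -> Prop) : Prop :=
  forall g, G g -> forall p, J (g p) <-> J p.

Definition stable (R : realType) (D : domain R)
  (G : (point D -> point D) -> Prop) : Prop :=
  finitely_generated G /\
  forall J, is_subdomain J ->
    (exists K, finite_index_subgroup K G /\ invariant K J) ->
    invariant G J.

(* Main.v *)
(** Call a tame set [J] (one with finitely many breakpoints) fin-tame when its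
    orbit [{J \o g | g in G}] is finite, as happens when [J] is invariant under
    a finite index subgroup. The subgroup [H] of [G] preserving all fin-tame
    sets is stable as soon as it has finite index; it is then finitely generated
    by Schreier's lemma.

    Points with finite [G]-orbit: slide the whole orbit of [x] to the left until
    one of its points hits a breakpoint of a generator. As all generators
    translate along the way, two elements of [G] that agree on the finite set of
    finite orbits containing breakpoints agree on all finite orbits.

    Points with infinite orbit: if [y] is a boundary point of a fin-tame [J],
    follow [y] along generators that are continuous from the left. All the points
    reached are boundary points of the finitely many [J \o g], so they are finite
    in number, and either one of them is a breakpoint or they form the whole orbit
    of [y]. Hence, off the finite orbits, fin-tame sets can only change across
    a finite set of points that is independent of [J]. *)

From mathcomp Require Import all_boot all_order all_algebra.
From mathcomp Require Import reals boolp classical_sets cardinality.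
From mathcomp Require Import lra.
From Stdlib Require List.
Require Import Defs.

Import Order.TTheory GRing.Theory Num.Theory.
Local Open Scope classical_set_scope.
Local Open Scope ring_scope.

(** * Choices from finite lists, and finite sets as lists *)

Section Lists.
Set Implicit Arguments.
Unset Strict Implicit.

Lemma list_choice (A B : Type) (P : A -> B -> Prop) (s : seq A) :
  (forall a, List.In a s -> exists b, P a b) ->
  exists t : seq B,
    (forall a, List.In a s -> exists2 b, List.In b t & P a b) /\
    (forall b, List.In b t -> exists2 a, List.In a s & P a b).
Proof.
elim: s => [|a s IH] H; first by exists [::].
have [b Pab] := H a (or_introl erefl).
have [t [t1 t2]] := IH (fun x sx => H x (or_intror sx)).
exists (b :: t); split=> [x [<-|/t1[y ty Pxy]]|y [<-|/t2[x sx Pxy]]].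
- by exists b => //; left.
- by exists y => //; right.
- by exists a => //; left.
- by exists x => //; right.
Qed.

(** A finite invariant [sigma] gives finitely many representatives; this serves below both for test
    points and for cosets. *)
Lemma list_reps (T : finType) (U : Type) (A : set U) (sigma : U -> T) :
  exists reps : seq U, (forall r, List.In r reps -> A r) /\
    forall u, A u -> exists2 r, List.In r reps & sigma r = sigma u.
Proof.
suff [reps [r1 r2]] : exists reps : seq U, (forall r, List.In r reps -> A r) /\
    forall u, A u -> sigma u \in enum T ->
    exists2 r, List.In r reps & sigma r = sigma u.
  by exists reps; split=> // u /r2; apply; rewrite mem_enum.
elim: (enum T) => [|t e [reps [r1 r2]]]; first by exists [::].
have [[u [Au ut]]|no] := EM (exists u, A u /\ sigma u = t).
  exists (u :: reps); split=> [r [<-|/r1]//|v Av].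
  rewrite inE => /orP[/eqP->|/(r2 _ Av)[r rr <-]]; first by exists u => //; left.
  by exists r => //; right.
exists reps; split=> // u Au; rewrite inE => /orP[/eqP ut|]; last exact: r2.
by case: no; exists u.
Qed.

Lemma finite_set_In (T : Type) (s : seq T) : finite_set [set x | List.In x s].
Proof.
elim: s => [|a s IH]; first by apply: sub_finite_set (finite_set0 _) => x.
apply: (@sub_finite_set _ _ ([set a] `|` [set x | List.In x s])).
  by move=> x /= [<-|]; [left|right].
by rewrite finite_setU; split=> //; exact: finite_set1.
Qed.

Lemma finite_set_seq (T : Type) (A : set T) : finite_set A ->
  exists s : seq T, forall x, A x <-> List.In x s.
Proof.
move=> /(@finite_seqP {classic T})[s ->]; exists s => x /=.
elim: s => [|a s IH] //=; rewrite inE; split=> [/orP[/eqP->|/IH]|[->|/IH ->]].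
- by left.
- by right.
- by rewrite eqxx.
- by rewrite orbT.
Qed.

End Lists.

(** * Words in a symmetric generating list, finite index and Schreier's lemma *)

Section Words.
Set Implicit Arguments.
Unset Strict Implicit.
Context {R : realType} {D : domain R}.
Implicit Types (f g h r s : point D -> point D) (S : seq (point D -> point D)).

Inductive word S : (point D -> point D) -> Prop :=
| word_nil : word S id
| word_cons s f : List.In s S -> word S f -> word S (s \o f).

Definition inverse_closed S := forall s, List.In s S ->
  exists2 s', List.In s' S & cancel s s' /\ cancel s' s.

Lemma word_comp S f g : word S f -> word S g -> word S (f \o g).
Proof.
move=> Sf Sg; elim: Sf => {f} [//|s f Ss _ IH].
exact: (word_cons Ss IH).
Qed.

Lemma word_gen S s : List.In s S -> word S s.
Proof. by move=> Ss; exact: (word_cons Ss (word_nil S)). Qed.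

Lemma word_subgroup S : inverse_closed S -> is_subgroup (word S).
Proof.
move=> Ssym; split; [exact: word_nil|split; first exact: word_comp].
move=> f; elim=> {f} [|s f Ss _ [g [Sg [fg gf]]]].
  by exists id; split=> //; exact: word_nil.
have [s' Ss' [ss' s's]] := Ssym _ Ss; exists (g \o s'); split.
  by apply: word_comp => //; exact: word_gen.
by split; exact: can_comp.
Qed.

Lemma subgroup_inverse H s s' :
  is_subgroup H -> H s -> cancel s s' -> cancel s' s -> H s'.
Proof.
move=> sH Hs ss' s's; have [_ [_ /(_ _ Hs)[g [Hg [sg gs]]]]] := sH.
suff -> : s' = g by [].
by apply/funext => x; rewrite -[in LHS](gs x) ss'.
Qed.

Lemma generated_word gens S : inverse_closed S ->
  (forall s, List.In s gens -> List.In s S) ->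
  (forall s, List.In s S -> List.In s gens \/
    exists2 g, List.In g gens & cancel g s /\ cancel s g) ->
  generated gens = word S.
Proof.
move=> Ssym sub sup; apply/funext => f; apply/propext; split=> [|Sf].
  apply; first exact: word_subgroup.
  by move=> g /sub; exact: word_gen.
move=> H sH Hg; elim: Sf => {f} [|s f Ss _ Hf]; first by case: sH.
have [_ [Hc _]] := sH; apply: Hc => //.
have [/Hg //|[g /Hg Hgg [gs sg]]] := sup _ Ss.
exact: (subgroup_inverse sH Hgg).
Qed.

Lemma finite_index_trans (G H K : (point D -> point D) -> Prop) :
  finite_index_subgroup H G -> finite_index_subgroup K H ->
  finite_index_subgroup K G.
Proof.
move=> [sH [HG [r1 r1P]]] [sK [KH [r2 r2P]]]; split=> //; split; first by auto.
exists (List.map (fun ab => ab.1 \o ab.2) (List.list_prod r1 r2)).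
move=> g /r1P[a [h [ar [Hh ->]]]]; have [b [k [br [Kk ->]]]] := r2P _ Hh.
exists (a \o b), k; split; last by [].
by apply/List.in_map_iff; exists (a, b); split=> //; apply/List.in_prod.
Qed.

(* Schreier: from [s \o r = r' \o h] with [r, r'] coset representatives, the
   elements [h], together with the representatives lying in [H], generate
   [H]. *)
Lemma finite_index_fg S H : inverse_closed S ->
  finite_index_subgroup H (word S) -> finitely_generated H.
Proof.
move=> Ssym [sH [HS [reps repsP]]].
have [H1 [Hc Hi]] := sH; have sW := word_subgroup Ssym.
have repW r h : H h -> word S (r \o h) -> word S r.
  move=> Hh Wrh; have [g [Hg [hg gh]]] := Hi _ Hh.
  have -> : r = (r \o h) \o g by apply/funext => x /=; rewrite gh.
  by apply: word_comp => //; exact: HS.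
(* [finite_index_subgroup] does not force representatives into the group, so the equation is
   demanded only when [sr.2] lies in it; other pairs get [id] as [h]. *)
pose P (sr : (point D -> point D) * (point D -> point D)) h :=
  H h /\ (word S sr.2 -> exists2 r, List.In r reps & sr.1 \o sr.2 = r \o h).
have [sr srP] : exists t, (forall a, List.In a (List.list_prod S reps) ->
     exists2 h, List.In h t & P a h) /\
    forall h, List.In h t -> exists2 a, List.In a (List.list_prod S reps) & P a h.
  apply: list_choice => -[s r] /List.in_prod_iff[Ss rr].
  have [Wr|nWr] := EM (word S r); last by exists id.
  have [r' [h [rr' [Hh e]]]] := repsP _ (word_cons Ss Wr).
  by exists h; split=> // _; exists r'.
have [inH [inH1 inH2]] : exists t, (forall a, List.In a reps ->
     exists2 h, List.In h t & (H a -> h = a) /\ H h) /\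
    forall h, List.In h t -> exists2 a, List.In a reps & (H a -> h = a) /\ H h.
  apply: list_choice => r _.
  by have [Hr|nHr] := EM (H r); [exists r|exists id].
exists (sr ++ inH) => f; split=> [Hf M sM MS|]; last first.
  apply=> // g /(List.in_app_or _ _ _)[/(proj2 srP)[a _ []]//|].
  by move=> /inH2[a _ []].
have [M1 [Mc Mi]] := sM.
have MrH r : List.In r reps -> H r -> M r.
  move=> /inH1[h hin [hr _]] /hr <-; apply: MS.
  by apply: List.in_or_app; right.
(* The representative is moved to the left through the letters of [g]; each letter leaves behind a
   factor lying in [M]. *)
have step g : word S g -> forall r, List.In r reps -> word S r ->
    exists r' h, [/\ List.In r' reps, word S r', M h, H h & g \o r = r' \o h].
  elim=> {g} [|s g Ss _ IH] r rr Wr; first by exists r, id; split.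
  have [r1 [h1 [rr1 Wr1 Mh1 Hh1 e1]]] := IH r rr Wr.
  have [|h hin [Hh /(_ Wr1)[r2 rr2 e2]]] := proj1 srP (s, r1).
    exact/List.in_prod.
  exists r2, (h \o h1); split=> //.
  - by apply: (repW _ h) => //; rewrite -e2; exact: word_cons.
  - by apply: Mc => //; apply: MS; apply: List.in_or_app; left.
  - exact: Hc.
  - rewrite -[(s \o g) \o r]/(s \o (g \o r)) e1.
    by rewrite -[s \o (r1 \o h1)]/((s \o r1) \o h1) e2.
(* [id] need not be a representative. Its coset is represented by some [r0] in [H], and [f] is
   recovered as [r \o h] composed with the inverse of [r0]. *)
have [r0 [h0 [rr0 [Hh0 e0]]]] := repsP _ (word_nil S).
have Hr0 : H r0.
  have [g [Hg [hg gh]]] := Hi _ Hh0.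
  have -> : r0 = g; last by [].
  by apply/funext => x; rewrite -[in LHS](gh x) -[r0 _]/((r0 \o h0) _) -e0.
have [r [h [rr Wr Mh Hh e]]] := step _ (HS _ Hf) _ rr0 (HS _ Hr0).
have Hr : H r.
  have [g [Hg [hg gh]]] := Hi _ Hh.
  have -> : r = (f \o r0) \o g by rewrite e; apply/funext => x /=; rewrite gh.
  by apply: (Hc) => //; exact: Hc.
have [g [Mg [rg gr]]] := Mi _ (MrH _ rr0 Hr0).
have -> : f = r \o h \o g by rewrite -e; apply/funext => x /=; rewrite gr.
by apply: (Mc) => //; apply: (Mc) => //; exact: MrH.
Qed.

End Words.

(** * Segments, breakpoints and boundary points of tame sets *)

Section Geometry.
Set Implicit Arguments.
Unset Strict Implicit.
Context {R : realType} {D : domain R}.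
Implicit Types (p q w x y z : point D) (u v : R) (L cs : seq R).
Implicit Types (s f g : point D -> point D) (J : set (point D)).

Lemma seq_min (e : seq R) (P : R -> Prop) : (exists2 a, a \in e & P a) ->
  exists a, [/\ a \in e, P a & forall b, b \in e -> P b -> a <= b].
Proof.
elim: e => [[a]//|a e IH] exP.
have [/IH[b [be Pb bP]]|no] := EM (exists2 b, b \in e & P b).
  have [[Pa ab]|nab] := EM (P a /\ a <= b).
    exists a; split; rewrite ?mem_head// => c; rewrite inE => /orP[/eqP->//|ce Pc].
    exact: le_trans ab (bP _ ce Pc).
  exists b; split; rewrite ?inE ?be ?orbT// => c.
  rewrite inE => /orP[/eqP->|/bP//] Pa; rewrite leNgt; apply/negP => /ltW ab.
  exact: nab.
have [b be Pb] := exP; move: be; rewrite inE => /orP[/eqP ba|be]; last first.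
  by case: no; exists b.
subst b; exists a; split; rewrite ?mem_head// => c.
by rewrite inE => /orP[/eqP->//|ce Pc]; case: no; exists c.
Qed.

Lemma seq_max (e : seq R) (P : R -> Prop) : (exists2 a, a \in e & P a) ->
  exists a, [/\ a \in e, P a & forall b, b \in e -> P b -> b <= a].
Proof.
move=> [a ae Pa].
have [|b [/mapP[c ce ->] Pc cP]] := @seq_min (map -%R e) (fun b => P (- b)).
  by exists (- a); rewrite ?opprK// map_f.
exists c; rewrite opprK in Pc; split=> // d de Pd.
by rewrite -lerN2 cP ?map_f ?opprK.
Qed.

Lemma map_In (T : Type) (F : T -> R) (e : seq T) a :
  List.In a e -> F a \in map F e.
Proof.
by elim: e => //= b e IH [->|/IH]; rewrite inE ?eqxx// => ->; rewrite orbT.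
Qed.

Lemma point_eq p q : comp p = comp q -> coord p = coord q -> p = q.
Proof.
case: p q => [i a a0 ai] [j b b0 bj] /= ij ab; subst j b.
by rewrite (bool_irrelevance a0 b0) (bool_irrelevance ai bj).
Qed.

Definition shift u p q := comp q = comp p /\ coord q = coord p + u.

Lemma shift_back q u : 0 <= u -> u <= coord q -> exists p, shift u p q.
Proof.
move=> u0 uq; have c0 : 0 <= coord q - u by rewrite subr_ge0.
have cl : coord q - u < len (comp q).
  by apply: le_lt_trans (coord_lt q); rewrite gerBl.
by exists (Point c0 cl); split=> //=; rewrite subrK.
Qed.

Lemma shift_fun u p q q' : shift u p q -> shift u p q' -> q = q'.
Proof. by move=> [a b] [c d]; apply: point_eq; congruence. Qed.

Lemma shift_inj u p p' q : shift u p q -> shift u p' q -> p = p'.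
Proof.
move=> [a b] [c d]; apply: point_eq; first congruence.
by apply: (addIr u); rewrite -b -d.
Qed.

(** Breakpoints are coordinates shared by all components. Pieces are closed on the left, so a break
    at [l] separates [l] from the points before it; hence the interval open at [p] and closed at
    [q]. *)
Definition gapfree L p q := forall l, l \in L -> coord p < l <= coord q -> False.

(* Finitely many translation lengths [cs] suffice: this keeps the set of
   breakpoints finite when a tame set is pulled back. *)
Definition translates L cs s := forall p q u,
  shift u p q -> 0 <= u -> gapfree L p q ->
  shift u (s p) (s q) /\ exists2 c, c \in cs & coord (s p) = coord p + c.

(** [L] lists the left ends of the pieces: a piece that contains [q] and does not start after [p]
    contains [p] too. *)
Lemma IET_translates s : is_IET s -> exists L cs, translates L cs s.
Proof.
move=> [_ [pcs [cov tr]]].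
exists (map (fun pc => pc.1.1.1.2) pcs), (map (fun pc => pc.2) pcs).
move=> p q u [pq qpu] u0 gf.
have [pc [inpc qpc]] := cov q; have [q1 [q2 q3]] := qpc.
have ppc : in_piece pc.1.1 p.
  split; first by rewrite -pq.
  split; last by apply: le_lt_trans q3; rewrite qpu lerDl.
  rewrite leNgt; apply/negP => lt; apply: (gf pc.1.1.1.2).
    exact: (map_In (fun pc => pc.1.1.1.2)).
  by rewrite lt q2.
have [cp sp] := tr _ inpc _ ppc; have [cq sq] := tr _ inpc _ qpc.
split; first by split; [rewrite cp|rewrite sq sp qpu addrAC].
by exists pc.2 => //; exact: (map_In (fun pc => pc.2)).
Qed.

Lemma IET_inverse f : is_IET f ->
  exists g, [/\ is_IET g, cancel f g & cancel g f].
Proof.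
move=> [[g fg gf] [pcs [cov tr]]]; exists g; split=> //; split; first by exists f.
(* A piece may overhang its component, so it is clipped before being translated; otherwise its
   translate could contain points that are not images of the piece. *)
pose inv (pc : 'I_(ncomp D) * R * R * 'I_(ncomp D) * R) :=
  (pc.1.2, Num.max pc.1.1.1.2 0 + pc.2,
   Num.min pc.1.1.2 (len pc.1.1.1.1) + pc.2, pc.1.1.1.1, - pc.2).
exists (List.map inv pcs); split=> [q|_ /List.in_map_iff[pc [<- pcin]] q].
  have [pc [pcin pq]] := cov (g q); exists (inv pc); split.
    by apply/List.in_map_iff; exists pc.
  have [] := tr _ pcin _ pq; rewrite gf => cq eq.
  have [c1 [c2 c3]] := pq.
  split=> //=; rewrite eq; split; rewrite ?lerD2r ?ltrD2r ?ge_max ?lt_min ?c2 ?c3//=.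
    exact: coord_ge0.
  by rewrite -c1 coord_lt.
case=> /= cq [q1 q2].
have c0 : 0 <= coord q - pc.2.
  rewrite subr_ge0; apply: le_trans q1; rewrite lerDr.
  by rewrite le_max lexx orbT.
have cl : coord q - pc.2 < len pc.1.1.1.1.
  by rewrite ltrBlDr; apply: lt_le_trans q2 _; rewrite lerD2r ge_min lexx orbT.
pose p := Point c0 cl.
have pin : in_piece pc.1.1 p.
  split=> //=; rewrite lerBrDr ltrBlDr; split.
    by apply: le_trans q1; rewrite lerD2r le_max lexx.
  by apply: lt_le_trans q2 _; rewrite lerD2r ge_min lexx.
have [cp fp] := tr _ pcin _ pin.
have <- : f p = q by apply: point_eq; [rewrite cp cq|rewrite fp /= subrK].
by rewrite fg /=; split=> //; rewrite fp /= addrK.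
Qed.

Lemma gapfree_sub L L' p q : {subset L <= L'} -> gapfree L' p q -> gapfree L p q.
Proof. by move=> LL gf l /LL; exact: gf. Qed.

(** Including [0] in [L] ensures that every point has an element of [L] at or below its
    coordinate. *)
Lemma translates_all (S : seq (point D -> point D)) :
  (forall s, List.In s S -> is_IET s) ->
  exists L cs, 0 \in L /\ forall s, List.In s S -> translates L cs s.
Proof.
elim: S => [_|s S IH IS]; first by exists [:: 0], [::]; rewrite mem_head.
have [|L [cs [L0 tr]]] := IH; first by move=> f Sf; apply: IS; right.
have [L' [cs' tr']] := IET_translates (IS s (or_introl erefl)).
exists (L ++ L'), (cs ++ cs'); split; first by rewrite mem_cat L0.
move=> f sf p q u pq u0 gf.
case: sf => [<-|/tr /(_ _ _ _ pq u0)].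
  have [|pq' [c cin e]] := tr' _ _ _ pq u0.
    by apply: gapfree_sub gf => l; rewrite mem_cat orbC => ->.
  by split=> //; exists c; rewrite // mem_cat cin orbT.
case=> [|pq' [c cin e]].
  by apply: gapfree_sub gf => l; rewrite mem_cat => ->.
by split=> //; exists c; rewrite // mem_cat cin.
Qed.

Definition tame J := exists L, forall p q u,
  shift u p q -> 0 <= u -> gapfree L p q -> J p = J q.

(** A break of [J \o s] is a break of [s], or is translated by some [c] in [cs] to a break [l] of
    [J] and so sits at [l - c]. *)
Lemma tame_comp L cs s J : translates L cs s -> tame J -> tame (J \o s).
Proof.
move=> tr [L' tJ]; exists (L ++ [seq l - c | l <- L', c <- cs]).
move=> p q u pq u0 gf /=.
have [|sh [c cin e]] := tr _ _ _ pq u0.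
  by apply: gapfree_sub gf => l; rewrite mem_cat => ->.
apply: (tJ _ _ u) => // l lL' /andP[l1 l2]; apply: (gf (l - c)).
  by rewrite mem_cat; apply/orP; right; apply/allpairsP; exists (l, c).
rewrite ltrBrDr lerBlDr -e l1 /=.
by case: sh => _; case: pq => _ -> se; rewrite addrAC -e -se.
Qed.

Lemma subdomain_tame J : is_subdomain J -> tame J.
Proof.
move=> [_ /choice[e eP]].
exists (flatten [seq map fst (e i) ++ map snd (e i) | i <- enum 'I_(ncomp D)]).
move=> p q u [cpq dpq] u0 gf; apply/propext.
rewrite (eP (comp p) p erefl) (eP (comp p) q cpq).
suff -> : has (fun ab => (ab.1 <= coord p) && (coord p < ab.2)) (e (comp p)) =
  has (fun ab => (ab.1 <= coord q) && (coord q < ab.2)) (e (comp p)) by [].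
have pq : coord p <= coord q by rewrite dpq lerDl.
apply: eq_in_has => -[a b] abin /=.
have inL l : l \in map fst (e (comp p)) ++ map snd (e (comp p)) ->
    (l <= coord p) = (l <= coord q).
  move=> lin; apply/idP/idP => [/le_trans-> //|lq].
  rewrite leNgt; apply/negP => pl; apply: (gf l); last by rewrite pl.
  apply/flattenP; exists (map fst (e (comp p)) ++ map snd (e (comp p))) => //.
  by apply: (map_f (fun i => map fst (e i) ++ map snd (e i))); rewrite mem_enum.
rewrite !ltNge !inL// mem_cat.
  by apply/orP; right; apply/mapP; exists (a, b).
by apply/orP; left; apply/mapP; exists (a, b).
Qed.

(* Only changes from the left count; points with coordinate [0] are vacuously
   boundary points. *)
Definition bd J y := forall p u, shift u p y -> 0 < u ->
  exists w v, [/\ shift v w y, 0 < v <= u & J w <> J y].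

Lemma finite_coord L : finite_set [set y : point D | coord y \in L].
Proof.
apply: (@sub_finite_set _ _ (\bigcup_(i in [set: 'I_(ncomp D)])
  \bigcup_(l in [set` L]) [set y | comp y = i /\ coord y = l])).
  by move=> y /= yL; exists (comp y) => //; exists (coord y).
apply: bigcup_finite => [|i _]; first exact: finite_finset.
apply: bigcup_finite => [|l _]; first exact: finite_seq.
have [[y [yi yl]]|no] := EM (exists y, comp y = i /\ coord y = l).
  apply: sub_finite_set (finite_set1 y) => z /= [zi zl].
  by apply: point_eq; congruence.
by apply: sub_finite_set (finite_set0 _) => z /= zi; apply: no; exists z.
Qed.

(** [J] is constant between consecutive breaks, so boundary points have their coordinates in
    [0 :: L]. *)
Lemma bd_finite J : tame J -> finite_set (bd J).
Proof.
move=> [L tJ]; apply: sub_finite_set (finite_coord (0 :: L)) => y ybd /=.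
apply/negPn/negP => yL.
have y0 : 0 < coord y.
  by rewrite lt_neqAle coord_ge0 andbT; apply: contra yL => /eqP <-; exact: mem_head.
have [|l [lL ly lmax]] := @seq_max (0 :: L) (fun l => l < coord y).
  by exists 0; rewrite ?mem_head.
have l0 : 0 <= l by apply: lmax; rewrite ?mem_head.
have [||p py] := @shift_back y (coord y - l).
- by rewrite subr_ge0 ltW.
- by rewrite gerBl.
have [|w [v [wy /andP[v0 vu]]]] := ybd _ _ py; first by rewrite subr_gt0.
apply; apply: (tJ _ _ _ wy (ltW v0)) => k kL /andP[wk ky].
have : k <= l.
  apply: lmax; first by rewrite inE kL orbT.
  rewrite lt_neqAle ky andbT; apply: contra yL => /eqP <-.
  by rewrite inE kL orbT.
by case: wy => _ e; lra.
Qed.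

(** Among [q] and the breaks after [p] up to [q], take the first point [y] where [J] differs from
    [J p]; just before [y] the value is still [J p]. *)
Lemma bd_exists J p q u : tame J -> shift u p q -> 0 <= u -> J p <> J q ->
  exists y v, [/\ shift v y q, 0 <= v < u & bd J y].
Proof.
move=> [L tJ] pq u0 Jpq.
pose P a := exists y v, [/\ shift v y q, 0 <= v < u, coord y = a & J y <> J p].
have u1 : 0 < u.
  rewrite lt_neqAle u0 andbT; apply/negP => /eqP u00.
  move: pq Jpq; rewrite -u00 => -[e1]; rewrite addr0 => e2; apply.
  by rewrite (point_eq e1 e2).
have [|a [aL [y [v [yq vu ya Jy]]] amin]] := @seq_min (coord q :: L) P.
  exists (coord q); first exact: mem_head.
  by exists q, 0; rewrite /shift addr0 lexx u1; split=> // /esym.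
exists y, v; split=> // p0 u' p0y u'0.
have [cpq dpq] := pq; have [cyq dyq] := yq; have /andP[v0 vlt] := vu.
have [cp0 dp0] := p0y.
(* The bound [u - v] keeps [w] from passing to the left of [p]. *)
pose t := Num.min u' (u - v).
have t0 : 0 < t by rewrite /t lt_min u'0 subr_gt0.
have tu' : t <= u' by rewrite /t ge_min lexx.
have tuv : t <= u - v by rewrite /t ge_min lexx orbT.
have := coord_ge0 p0; have := coord_ge0 p => p00 p000.
have [||w wy] := @shift_back y t; [lra|lra|].
exists w, t; rewrite t0 tu'; split=> //; suff -> : J w = J p by move/esym.
have [cwy dwy] := wy.
(* [b] is the last break between [p] and [w], or [p] itself. [J] is constant from there to [w], and
   minimality of [a] forces the value [J p]. *)
have [|b [bL [bp bw] bmax]] := @seq_max (coord p :: L)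
   (fun b => coord p <= b /\ b <= coord w).
  by exists (coord p); [exact: mem_head|split; lra].
have [||z zw] := @shift_back w (coord w - b); [lra|lra|].
have [czw dzw] := zw.
have zb : coord z = b by lra.
transitivity (J z).
  symmetry; apply: (tJ _ _ _ zw); first lra.
  move=> l lL /andP[l1 l2]; have : l <= b; last by lra.
  by apply: bmax; [rewrite inE lL orbT|split; lra].
apply: contrapT => Jz.
have : a <= b; last by lra.
apply: amin.
  move: bL; rewrite !inE => /orP[/eqP bp'|->]; last by rewrite orbT.
  by case: Jz; congr J; apply: point_eq; [congruence|lra].
exists z, (v + t + (coord w - b)); split=> //; last first.
  apply/andP; split; first by lra.
  suff : coord z <> coord p by move/eqP; rewrite neq_lt => /orP[]; lra.
  by move=> e; case: Jz; congr J; apply: point_eq => //; congruence.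
split; [congruence|lra].
Qed.

End Geometry.

(** * Finite orbits, left-continuous connections and the index of [fix_tame] *)

Section Dynamics.
Set Implicit Arguments.
Unset Strict Implicit.
Context {R : realType} {D : domain R} {S : seq (point D -> point D)}.
Context {L cs : seq R}.
Context (Ssym : inverse_closed S) (L0 : 0 \in L).
Context (tr : forall s, List.In s S -> translates L cs s).
Implicit Types (p q w x y z : point D) (u v : R).
Implicit Types (s f g h : point D -> point D) (J : set (point D)).

Let W : set (point D -> point D) := word S.

Lemma word_inverse g : W g -> exists h, [/\ W h, cancel g h & cancel h g].
Proof.
by have [_ [_ Hi]] := word_subgroup Ssym; move=> /Hi[h [Wh [gh hg]]]; exists h.
Qed.

Lemma word_tame g J : W g -> tame J -> tame (J \o g).
Proof.
move=> Wg; elim: Wg J => {g} [//|s f Ss _ IH] J tJ.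
exact: (IH (J \o s) (tame_comp (tr Ss) tJ)).
Qed.

Definition orb x : set (point D) := [set y | exists2 g, word S g & g x = y].
Definition fin_orb x := finite_set (orb x).

Lemma orb_trans x y : orb x y -> orb y `<=` orb x.
Proof.
move=> [g Wg <-] z [h Wh <-]; exists (h \o g) => //; exact: word_comp.
Qed.

Lemma orb_sym x y : orb x y -> orb y x.
Proof.
by move=> [g Wg <-]; have [h [Wh gh hg]] := word_inverse Wg; exists h.
Qed.

Lemma orb_refl x : orb x x.
Proof. by exists id => //; exact: word_nil. Qed.

Lemma fin_orb_trans x y : orb x y -> fin_orb x -> fin_orb y.
Proof. by move=> xy; apply: sub_finite_set; exact: orb_trans. Qed.

Lemma fin_orb_word x g : W g -> fin_orb (g x) -> fin_orb x.
Proof. by move=> Wg; apply: fin_orb_trans; apply: orb_sym; exists g. Qed.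

(* The segments of length [u] to the left of the points of [O] contain no
   breakpoint, except possibly at their left ends. *)
Lemma slide_word (O : set (point D)) u :
  (forall z s, List.In s S -> O z -> O (s z)) ->
  (forall z l, O z -> l \in L -> l <= coord z -> l <= coord z - u) ->
  forall g, W g -> forall z w v, O z -> 0 <= v <= u -> shift v w z ->
  shift v (g w) (g z) /\ O (g z).
Proof.
move=> OS OL g Wg z w v Oz /andP[v0 vu] wz.
elim: Wg => {g} [//|s f Ss _ [sh Of]] /=; split; last exact: OS.
apply: (proj1 (tr Ss sh v0 _)) => l lL /andP[l1 l2].
have := OL _ _ Of lL l2; case: sh => _; lra.
Qed.

Definition sing_fin_orb y :=
  fin_orb y /\ exists2 z, orb y z & coord z \in L.

(** [u] is the least distance from an orbit point back to an element of [L]: up to length [u] the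
    orbit moves rigidly, and at length [u] some orbit point lands on [L]. *)
Lemma slide x : fin_orb x -> exists u x',
  [/\ shift u x' x, 0 <= u, sing_fin_orb x' &
   forall v w, 0 <= v <= u -> shift v w x ->
   fin_orb w /\ forall g, W g -> shift v (g w) (g x)].
Proof.
move=> fx; have [O OP] := finite_set_seq fx.
pose P a := exists z l, [/\ orb x z, l \in L, l <= coord z & a = coord z - l].
have [|u [_ [z [l [xz lL lz ue]]] umin]] :=
    @seq_min _ (flatten [seq [seq coord z - l | l <- L] | z <- O]) P.
  exists (coord x - 0); last first.
    by exists x, 0; split=> //; [exact: orb_refl|exact: coord_ge0].
  elim: (O) (proj1 (OP x) (orb_refl x)) => //= y e IH.
  rewrite mem_cat => -[->|/IH ->]; last by rewrite orbT.
  by apply/orP; left; apply/mapP; exists 0.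
have u0 : 0 <= u by rewrite ue subr_ge0.
have OL y k : orb x y -> k \in L -> k <= coord y -> k <= coord y - u.
  move=> xy kL ky; have : u <= coord y - k; last by lra.
  apply: umin; last by exists y, k.
  elim: (O) (proj1 (OP y) xy) => //= a e IH.
  rewrite mem_cat => -[->|/IH ->]; last by rewrite orbT.
  by apply/orP; left; apply/mapP; exists k.
have OS y s : List.In s S -> orb x y -> orb x (s y).
  by move=> Ss xy; apply: (orb_trans xy); exists s => //; exact: word_gen.
have sl g v w : W g -> 0 <= v <= u -> shift v w x -> shift v (g w) (g x).
  by move=> Wg vu wx; have [] := slide_word OS OL Wg (orb_refl x) vu wx.
(* The orbit of [w] lies in the orbit of [x] moved back by [v]. *)
have finw v w : 0 <= v <= u -> shift v w x -> fin_orb w.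
  move=> vu wx; apply: (@sub_finite_set _ _
    (\bigcup_(y in orb x) [set p | shift v p y])).
    by move=> _ [g Wg <-]; exists (g x); [exists g|exact: sl].
  apply: bigcup_finite => // y _.
  have [[p py]|no] := EM (exists p, shift v p y).
    apply: sub_finite_set (finite_set1 p) => q /= qy.
    exact: shift_inj qy py.
  by apply: sub_finite_set (finite_set0 _) => p py; apply: no; exists p.
(* [0 \in L] forces [u <= coord x], so the slide stays within the component. *)
have [||x' x'x] := @shift_back _ _ x u => //.
  by rewrite -subr_ge0; apply: OL; [exact: orb_refl| |exact: coord_ge0].
exists u, x'; split=> //; last first.
  by move=> v w vu wx; split=> [|g Wg]; [exact: finw wx|exact: sl].
have uu : 0 <= u <= u by rewrite u0 lexx.
split; first exact: finw x'x.
have [g Wg gx] := xz; exists (g x'); first by exists g.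
have [_ e] := sl g _ _ Wg uu x'x.
by suff -> : coord (g x') = l by []; rewrite gx in e; lra.
Qed.

(** These points fill the finite orbits of the finitely many points with coordinate in [L]. *)
Lemma sing_fin_orb_finite : finite_set sing_fin_orb.
Proof.
apply: (@sub_finite_set _ _ (\bigcup_(e in [set e : point D | coord e \in L])
    [set y | fin_orb e /\ orb e y])).
  move=> y [fy [z yz zL]]; exists z => //; split; last exact: orb_sym.
  exact: fin_orb_trans fy.
apply: bigcup_finite => [|e _]; first exact: finite_coord.
have [fe|nfe] := EM (fin_orb e).
  by apply: (sub_finite_set _ fe) => y [].
by apply: sub_finite_set (finite_set0 _) => y [].
Qed.

(** Continuity from the left, witnessed by a segment inside the component: a point with coordinate
    [0] is never regular, even on a circle. *)
Definition regular s y := exists p u, [/\ shift u p y, 0 < u &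
  forall w v, 0 <= v <= u -> shift v w y -> shift v (s w) (s y)].

Lemma nonsing_regular s y : List.In s S -> coord y \notin L -> regular s y.
Proof.
move=> Ss yL.
have y0 : 0 < coord y.
  by rewrite lt_neqAle coord_ge0 andbT; apply: contra yL => /eqP <-.
have [|l [lL ly lmax]] := @seq_max _ L (fun l => l < coord y); first by exists 0.
have l0 : 0 <= l by apply: lmax.
have [||p py] := @shift_back _ _ y (coord y - l); [lra|lra|].
exists p, (coord y - l); split=> //; first by rewrite subr_gt0.
move=> w v /andP[v0 vl] wy.
apply: (proj1 (tr Ss wy v0 _)) => k kL /andP[wk ky].
have : k <= l.
  apply: lmax => //; rewrite lt_neqAle ky andbT.
  by apply: contra yL => /eqP <-.
by case: wy => _ e; lra.
Qed.

(** [s] carries a segment ending at [y] rigidly onto one ending at [s y], and [s'] carries it back.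
    This makes [rconn] symmetric. *)
Lemma regular_inv s s' y : cancel s s' -> cancel s' s ->
  regular s y -> regular s' (s y).
Proof.
move=> ss' s's [p [u [py u0 sy]]].
have := coord_ge0 p => p0; have [_ dpy] := py.
have uu : 0 <= u <= u by rewrite lexx ltW.
exists (s p), u; split=> //; first exact: sy.
move=> w v /andP[v0 vu] wsy; rewrite ss'.
have [||w' w'y] := @shift_back _ _ y v => //; first by lra.
have : shift v (s w') (s y) by apply: sy => //; rewrite v0.
by move=> /(shift_inj wsy) ->; rewrite ss'.
Qed.

(* Left-continuous steps only: these are the steps that carry boundary points to
   boundary points. *)
Inductive rconn y : point D -> Prop :=
| rconn_refl : rconn y y
| rconn_step s z : rconn y z -> List.In s S -> regular s z -> rconn y (s z).

Lemma rconn_trans x y z : rconn x y -> rconn y z -> rconn x z.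
Proof. by move=> xy; elim=> // s w _ xw Ss sw; exact: rconn_step. Qed.

Lemma rconn_sym x y : rconn x y -> rconn y x.
Proof.
elim=> [|s z _ zx Ss sz]; first exact: rconn_refl.
apply: rconn_trans zx; have [s' Ss' [ss' s's]] := Ssym Ss.
rewrite -{2}(ss' z); apply: rconn_step => //; first exact: rconn_refl.
exact: regular_inv.
Qed.

Definition sing_fin_rconn y :=
  finite_set (rconn y) /\ exists2 z, rconn y z & coord z \in L.

Lemma sing_fin_rconn_finite : finite_set sing_fin_rconn.
Proof.
apply: (@sub_finite_set _ _ (\bigcup_(e in [set e : point D | coord e \in L])
    [set y | finite_set (rconn e) /\ rconn e y])).
  move=> y [fy [z yz zL]]; exists z => //; split; last exact: rconn_sym.
  by apply: sub_finite_set fy => w; exact: rconn_trans.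
apply: bigcup_finite => [|e _]; first exact: finite_coord.
have [fe|nfe] := EM (finite_set (rconn e)).
  by apply: (sub_finite_set _ fe) => y [].
by apply: sub_finite_set (finite_set0 _) => y [].
Qed.

(** The nearby points [w] where [J] differs from [J y] move along with [y], and [J \o s'] at [s w]
    is [J w]. *)
Lemma bd_regular J s s' y : cancel s s' -> regular s y -> bd J y ->
  bd (J \o s') (s y).
Proof.
move=> ss' [p0 [u0 [p0y u00 sy]]] Jy p u psy u1.
have := coord_ge0 p0 => c0; have [_ dp0] := p0y.
pose t := Num.min u u0.
have t0 : 0 < t by rewrite /t lt_min u1.
have tu : t <= u by rewrite /t ge_min lexx.
have tu0 : t <= u0 by rewrite /t ge_min lexx orbT.
have [||a ay] := @shift_back _ _ y t; [lra|lra|].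
have [w [v [wy /andP[v0 vt] Jw]]] := Jy _ _ ay t0.
exists (s w), v; rewrite /= !ss'; split=> //; last by rewrite v0 (le_trans vt).
by apply: sy => //; rewrite ltW//= (le_trans vt).
Qed.

Definition fin_tame J := tame J /\ finite_set [set J \o g | g in W].

Lemma fin_tame_comp J g : W g -> fin_tame J -> fin_tame (J \o g).
Proof.
move=> Wg [tJ fJ]; split; first exact: word_tame.
apply: sub_finite_set fJ => _ [h Wh <-]; exists (g \o h) => //.
exact: word_comp.
Qed.

Lemma bd_rconn J y z : bd J y -> rconn y z -> exists2 g, W g & bd (J \o g) z.
Proof.
move=> Jy; elim=> [|s w _ [g Wg gw] Ss sw]; first by exists id => //; exact: word_nil.
have [s' Ss' [ss' s's]] := Ssym Ss.
exists (g \o s'); first by apply: word_comp => //; exact: word_gen.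
exact: (bd_regular ss' sw gw).
Qed.

Lemma bd_fin_rconn J y : fin_tame J -> bd J y -> finite_set (rconn y).
Proof.
move=> [tJ fJ] Jy.
apply: (@sub_finite_set _ _ (\bigcup_(K in [set J \o g | g in W]) bd K)).
  by move=> z /(bd_rconn Jy)[g Wg gz]; exists (J \o g) => //; exists g.
by apply: bigcup_finite => // _ [g Wg <-]; apply: bd_finite; exact: word_tame.
Qed.

(** If no point reached from [y] has coordinate in [L], every generator is regular at every such
    point, so the finite set [rconn y] exhausts the orbit. *)
Lemma bd_sing_or_fin J y : fin_tame J -> bd J y -> sing_fin_rconn y \/ fin_orb y.
Proof.
move=> BJ /(bd_fin_rconn BJ) fy.
have [ex|no] := EM (exists2 z, rconn y z & coord z \in L); first by left.
right; apply: sub_finite_set fy => _ [g Wg <-].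
elim: Wg => {g} [|s f Ss _ yf]; first exact: rconn_refl.
apply: (rconn_step yf Ss); apply: nonsing_regular => //.
by apply/negP => fL; apply: no; exists (f y).
Qed.

Section Signature.
Context (C : seq R).
Context (CP : forall y, sing_fin_orb y \/ sing_fin_rconn y -> coord y \in C).

(* The second component tells points of [C] apart, so that equal signatures force
   equality of points with coordinate in [C]. *)
Definition sig p : 'I_(ncomp D) * (size C).-tuple (bool * bool) :=
  (comp p, map_tuple (fun l => (l <= coord p, l == coord p)) (in_tuple C)).

Lemma sigP p q : sig p = sig q -> comp p = comp q /\ forall l, l \in C ->
  (l <= coord p) = (l <= coord q) /\ (l == coord p) = (l == coord q).
Proof.
move=> [-> /eq_in_map e]; split=> // l lC.
by have [-> ->] := e l lC.
Qed.

(** A change of [J] yields a boundary point [y] after [p] and up to [q]. If its coordinate is in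
    [C], the signatures differ. Otherwise [y] has a finite orbit and slides to some [y'] with
    coordinate in [C], hence at or before [p]; then [p] is on the sliding segment and has a finite
    orbit. *)
Lemma fin_tame_sig J p q : fin_tame J -> ~ fin_orb p -> ~ fin_orb q ->
  sig p = sig q -> J p = J q.
Proof.
move=> BJ; wlog pq : p q / coord p <= coord q.
  by move=> H np nq e; have [/H->//|/ltW/H->] := leP (coord p) (coord q).
move=> np nq /sigP[cpq e]; apply: contrapT => Jpq.
have sh : shift (coord q - coord p) p q by split; [|lra].
have [|y [v [yq /andP[v0 vu] Jy]]] := bd_exists (proj1 BJ) sh _ Jpq; first by lra.
have [cyq dyq] := yq.
have Cle z : coord z \in C -> coord z <= coord q -> coord z <= coord p.
  by move=> /e[-> _].
case: (bd_sing_or_fin BJ Jy) => [yZ|/slide[t [y' [y'y t0 Yy' ys]]]].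
  by have := Cle y (CP (or_intror yZ)); lra.
have [cy' dy'] := y'y.
have y'p : coord y' <= coord p by apply: Cle; [exact: CP (or_introl Yy')|lra].
apply: np; apply: (proj1 (ys (coord y - coord p) p _ _)).
  by apply/andP; split; lra.
by split; [congruence|lra].
Qed.

End Signature.

Definition fix_tame : set (point D -> point D) :=
  [set h | W h /\ forall J, fin_tame J -> J \o h = J].

Lemma fix_tame_subgroup : is_subgroup fix_tame.
Proof.
split; first by split; first exact: word_nil.
split=> [f g [Wf Jf] [Wg Jg]|f [Wf Jf]].
  split; first exact: word_comp.
  by move=> J BJ; rewrite -[RHS](Jg _ BJ) -[in RHS](Jf _ BJ).
have [g [Wg fg gf]] := word_inverse Wf; exists g; split=> //; split=> // J BJ.
by rewrite -[in LHS](Jf _ BJ); apply/funext => x /=; rewrite gf.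
Qed.

(** The coset of [g] is determined by the signatures of the images under [g] of finitely many test
    points: [Y] for finite orbits, and [Q], one point for each signature occurring on an infinite
    orbit. *)
Lemma fix_tame_finite_index : finite_index_subgroup fix_tame W.
Proof.
split; first exact: fix_tame_subgroup.
split; first by move=> h [].
have [C CP] : exists C : seq R,
    forall y, sing_fin_orb y \/ sing_fin_rconn y -> coord y \in C.
  have : finite_set (@coord R D @` (sing_fin_orb `|` sing_fin_rconn)).
    apply: finite_image; rewrite finite_setU; split.
      exact: sing_fin_orb_finite.
    exact: sing_fin_rconn_finite.
  move=> /finite_seqP[C eC]; exists C => y Yy.
  suff : [set` C] (coord y) by [].
  by rewrite -eC; exists y.
have [Y YP] := finite_set_seq sing_fin_orb_finite.
have [Q [Q1 Q2]] := list_reps [set p | ~ fin_orb p] (sig C).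
pose phi g : (size (Y ++ Q)).-tuple _ :=
  map_tuple (fun x => sig C (g x)) (in_tuple (Y ++ Q)).
have phiP g h x : phi g = phi h -> List.In x Y \/ List.In x Q ->
    sig C (g x) = sig C (h x).
  move=> pe xin; have {xin} : List.In x (Y ++ Q) by exact: List.in_or_app.
  move: (congr1 (@tval _ _) pe); rewrite /phi /=.
  elim: (Y ++ Q) => //= y A IH e [<-|].
    exact: (congr1 (head (sig C y)) e).
  exact: IH (congr1 behead e).
have [reps [r1 r2]] := list_reps W phi.
exists reps => g Wg; have [r rr e] := r2 _ Wg; have Wr := r1 _ rr.
have [r' [Wr' r'r rr']] := word_inverse Wr.
exists r, (r' \o g); split=> //; split; last by apply/funext => x /=; rewrite rr'.
split; first exact: word_comp.
(* [r y] is again in [sing_fin_orb], so its coordinate is in [C] and the equality test in the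
   signature gives [g y = r y]. *)
have YE y : sing_fin_orb y -> g y = r y.
  move=> Yy; have [cyy le] := sigP (phiP _ _ _ e (or_introl (proj1 (YP _) Yy))).
  apply: point_eq; rewrite // ?cyy//.
  have Yr : coord (r y) \in C.
    apply: CP; left; case: Yy => fy [z yz zL].
    have ory : orb y (r y) by exists r.
    split; first exact: fin_orb_trans fy.
    by exists z => //; exact: orb_trans (orb_sym ory) _ yz.
  by have [_] := le _ Yr; rewrite eqxx => /esym/eqP ->.
suff key J : fin_tame J -> J \o g = J \o r.
  move=> J BJ; have := key _ (fin_tame_comp Wr' BJ).
  rewrite -[J \o (r' \o g)]/((J \o r') \o g) => ->.
  by apply/funext => x /=; rewrite r'r.
move=> BJ; apply/funext => x /=.
have [/slide[u [x' [x'x u0 Yx' xs]]]|nx] := EM (fin_orb x).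
  have [|_ sh] := xs u x' _ x'x; first by rewrite u0 lexx.
  congr J; apply: (shift_fun (sh _ Wg)); rewrite YE//; exact: sh.
(* On an infinite orbit, [x] is replaced by the test point [q] of the same signature, since [J \o g]
   and [J \o r] are fin-tame as well. *)
have [q qQ eq] := Q2 _ nx; have nq := Q1 _ qQ.
rewrite -[J (g x)](fin_tame_sig CP (fin_tame_comp Wg BJ) nq nx eq) /=.
rewrite -[J (r x)](fin_tame_sig CP (fin_tame_comp Wr BJ) nq nx eq) /=.
apply: (fin_tame_sig CP BJ); last by apply: phiP => //; right.
- by move/(fin_orb_word Wg).
- by move/(fin_orb_word Wr).
Qed.

(** Writing the inverse of [g] as [r \o k] with [k] in [K], the set [J \o g] is the image of [J]
    under [r], which leaves finitely many possibilities. *)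
Lemma invariant_fin_tame (K : (point D -> point D) -> Prop) J :
  finite_index_subgroup K W -> invariant K J -> tame J -> fin_tame J.
Proof.
move=> [sK [KW [reps repsP]]] KJ tJ; split=> //.
pose F r : set (point D) := [set z | exists2 v, r v = z & J v].
apply: (sub_finite_set _ (finite_image F (finite_set_In reps))).
move=> _ [g Wg <-]; have [h [Wh gh hg]] := word_inverse Wg.
have [r [k [rr [Kk e]]]] := repsP _ Wh.
have [_ [_ /(_ _ Kk)[k' [_ [kk' k'k]]]]] := sK.
exists r => //; apply/funext => z; apply/propext; split=> /=.
  move=> [v rv Jv]; apply/(KJ _ Kk).
  suff -> : k (g z) = v by [].
  rewrite -rv -[v]k'k -[r (k _)]/((r \o k) _) -e.
  by rewrite hg.
move=> Jg; exists (k (g z)); last exact/(KJ _ Kk).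
by rewrite -[r (k _)]/((r \o k) _) -e gh.
Qed.

(** A finite index subgroup of [fix_tame] has finite index in the whole group, so a subdomain
    invariant under it is fin-tame. *)
Lemma fix_tame_stable : stable fix_tame.
Proof.
split; first exact: finite_index_fg Ssym fix_tame_finite_index.
move=> J sJ [K [fK KJ]] h [Wh hB] p.
have fKW := finite_index_trans fix_tame_finite_index fK.
have BJ := invariant_fin_tame fKW KJ (subdomain_tame sJ).
by rewrite -[J (h p)]/((J \o h) p) hB.
Qed.

End Dynamics.

Theorem mainTheorem7 (R : realType) (D : domain R)
  (gens : seq (point D -> point D)) :
  (forall g, List.In g gens -> is_IET g) ->
  exists H : (point D -> point D) -> Prop,
    finite_index_subgroup H (generated gens) /\ stable H.
Proof.
move=> gI.
(* Inverses are adjoined so that words in the enlarged list already form a group. *)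
have [invs [i1 i2]] := list_choice (fun g gin => IET_inverse (gI g gin)).
have Ssym : inverse_closed (gens ++ invs).
  move=> s /(List.in_app_or _ _ _)[/i1[s' s'in [_ ss' s's]]|/i2[g gin [_ ss' s's]]].
    by exists s' => //; apply: List.in_or_app; right.
  by exists g => //; apply: List.in_or_app; left.
have SI s : List.In s (gens ++ invs) -> is_IET s.
  by move=> /(List.in_app_or _ _ _)[/gI//|/i2[g _ []]].
have [L [cs [L0 tr]]] := translates_all SI.
have GW : generated gens = word (gens ++ invs).
  apply: generated_word => // [s sin|s /(List.in_app_or _ _ _)[|/i2[g gin [_ gs sg]]]].
  - by apply: List.in_or_app; left.
  - by left.
  - by right; exists g.
exists (fix_tame (S := gens ++ invs)); rewrite GW; split.
  exact: fix_tame_finite_index Ssym L0 tr.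
exact: fix_tame_stable Ssym L0 tr.
Qed.
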